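(* Let $L$ be the subalgebra of $\mathcal{T}$ generated by $\{\omega_n \mid n\ge 0\}$, where $\omega_n=gh^n$. Then, as bialgebras, $L\cong \mathcal{B}_{\mathrm{FdB}}^{\mathrm{nc}}$. Thus the noncommutative Faà di Bruno bialgebra $\mathcal{B}_{\mathrm{FdB}}^{\mathrm{nc}}$ is (isomorphic to) a sub-bialgebra of $\mathcal{T}$.
   Context: $\mathbb{K}$ is a field. $\mathcal{T}=\mathbb{K}\langle g,h\rangle$ is the free associative algebra on $g,h$, made into a bialgebra by $\Delta(g)=g\otimes g$, $\Delta(h)=1\otimes h+h\otimes g$, $\epsilon(g)=1$, $\epsilon(h)=0$. For $n\ge 0$, $\omega_n=g\underbrace{h\cdots h}_{n}$ (so $\omega_0=g$). The noncommutative Faà di Bruno bialgebra $\mathcal{B}_{\mathrm{FdB}}^{\mathrm{nc}}$ is the free algebra $\mathbb{K}\langle a_0,a_1,a_2,\ldots\rangle$ with counit $\epsilon(a_n)=\delta_{n,0}$ and coproduct $$\Delta(a_n)=\sum_{k=0}^{n}a_k\otimes\sum_{\substack{i_0+i_1+\cdots+i_k=n-k\\ i_0,\ldots,i_k\ge 0}}a_{i_0}a_{i_1}\cdots a_{i_k}.$$ *)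

(* Defs.v *)
From HB Require Import structures.
From mathcomp Require Import all_boot all_algebra.
From mathcomp Require Import finmap monalg.
From mathcomp Require Import boolp classical_sets.

Set Implicit Arguments.
Unset Strict Implicit.
Unset Printing Implicit Defensive.

Import GRing.Theory.
Local Open Scope ring_scope.
Local Open Scope quotient_scope.

(* The basic operations are locked, to keep conversion from unfolding them. *)
Fact tensor_key : unit. Proof. by []. Qed.

Section TensorDef.
Variables (K : fieldType) (U V : lmodType K).

(* U (x) V is the free module on U * V modulo the submodule spanned by the
   bilinearity relations. *)
Inductive tensor_rel : {malg K[(U * V)%type]} -> Prop :=
| tensor_rel0 : tensor_rel 0
| tensor_relD c x y :
    tensor_rel x -> tensor_rel y -> tensor_rel (c *: x + y)
| tensor_rel_linl c u u' v :
    tensor_rel (<<(c *: u + u', v)>> - (c *: <<(u, v)>> + <<(u', v)>>))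
| tensor_rel_linr c u v v' :
    tensor_rel (<<(u, c *: v + v')>> - (c *: <<(u, v)>> + <<(u, v')>>)).

Definition tensor_null : pred {malg K[(U * V)%type]} :=
  fun x => `[< tensor_rel x >].

Lemma tensor_nullZ c x : tensor_null x -> tensor_null (c *: x).
Proof.
move=> /asboolP hx; apply/asboolP; rewrite -[c *: x]addr0.
by apply: tensor_relD => //; apply: tensor_rel0.
Qed.

Lemma tensor_null_zmod_closed : zmod_closed tensor_null.
Proof.
split=> [|x y /asboolP hx /asboolP hy]; apply/asboolP; first exact: tensor_rel0.
by rewrite -scaleN1r addrC; apply: tensor_relD.
Qed.

HB.instance Definition _ :=
  GRing.isZmodClosed.Build _ tensor_null tensor_null_zmod_closed.

Definition tensor_null_closed : zmodClosed {malg K[(U * V)%type]} :=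
  GRing.ZmodClosed.clone _ tensor_null _.

Definition tensor : Type := {ideal_quot tensor_null_closed}.
HB.instance Definition _ := Choice.on tensor.
HB.instance Definition _ := GRing.Zmodule.on tensor.

Definition tpi (x : {malg K[(U * V)%type]}) : tensor := \pi_{ideal_quot tensor_null_closed} x.
Definition trepr (t : tensor) : {malg K[(U * V)%type]} :=
  repr (t : {ideal_quot tensor_null_closed}).

Lemma treprK t : tpi (trepr t) = t. Proof. exact: reprK. Qed.

Lemma tpi_eq x y : tpi x = tpi y <-> tensor_rel (x - y).
Proof.
split=> [/eqP|h]; last first.
  by apply/eqP; rewrite /tpi -Quotient.idealrBE; apply/asboolP.
by rewrite /tpi -Quotient.idealrBE => /asboolP.
Qed.

Lemma tpiD : {morph tpi : x y / x + y}.
Proof. exact: (@raddfD _ _ (\pi_{ideal_quot tensor_null_closed})). Qed.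

Definition tscale : K -> tensor -> tensor :=
  locked_with tensor_key (fun c t => tpi (c *: trepr t)).

Lemma tscale_pi c x : tscale c (tpi x) = tpi (c *: x).
Proof.
rewrite /tscale unlock; apply/tpi_eq; rewrite -scalerBr; apply/asboolP; apply: tensor_nullZ.
by apply/asboolP/tpi_eq; rewrite treprK.
Qed.

Lemma tscaleA a b t : tscale a (tscale b t) = tscale (a * b) t.
Proof. by rewrite -[t]treprK !tscale_pi scalerA. Qed.

Lemma tscale1 : left_id 1 tscale.
Proof. by move=> t; rewrite -[t]treprK tscale_pi scale1r. Qed.

Lemma tscaleDr : right_distributive tscale +%R.
Proof.
by move=> c s t; rewrite -[s]treprK -[t]treprK -tpiD !tscale_pi scalerDr tpiD.
Qed.

Lemma tscaleDl t : {morph tscale^~ t : a b / a + b}.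
Proof. by move=> a b; rewrite -[t]treprK !tscale_pi scalerDl tpiD. Qed.

HB.instance Definition _ := GRing.Zmodule_isLmodule.Build K tensor
  tscaleA tscale1 tscaleDr tscaleDl.

Lemma tpiZ c x : tpi (c *: x) = c *: tpi x.
Proof. by rewrite -tscale_pi. Qed.

Definition tens : U -> V -> tensor :=
  locked_with tensor_key (fun u v => tpi <<(u, v)>>).

Lemma tensE u v : tens u v = tpi <<(u, v)>>.
Proof. by rewrite /tens unlock. Qed.

Lemma tens_linl v : linear (tens^~ v).
Proof. by move=> c u u'; rewrite !tensE -tpiZ -tpiD; apply/tpi_eq/tensor_rel_linl. Qed.

Lemma tens_linr u : linear (tens u).
Proof. by move=> c v v'; rewrite !tensE -tpiZ -tpiD; apply/tpi_eq/tensor_rel_linr. Qed.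

Lemma tens_ind (P : tensor -> Prop) :
  P 0 -> (forall c u v t, P t -> P (c *: tens u v + t)) -> forall t, P t.
Proof.
move=> P0 PD t; rewrite -[t]treprK; set x := trepr t.
rewrite [x]monalgE; elim: (X in \sum_(k <- X) _) => [|[u v] s IH].
  by rewrite big_nil (_ : tpi 0 = 0) // /tpi raddf0.
rewrite big_cons tpiD; set y := \sum_(_ <- _) _ in IH *.
suff -> : << x@_(u, v) *g (u, v) >> = x@_(u, v) *: <<(u, v)>>.
  by rewrite tpiZ -tensE; apply: PD.
by apply/malgP => k; rewrite mcoeffZ !mcoeffU mulr_natr.
Qed.

End TensorDef.

Arguments tensor {K} (U V)%_type.
Arguments tens {K} {U V}%_type (u v)%_R.

Notation "U ⊗ V" := (tensor U V) (at level 40, left associativity) : type_scope.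
Notation "u ⊗ v" := (tens u v) (at level 40, left associativity) : ring_scope.

Lemma linear_map0 (K : fieldType) (U V : lmodType K) (f : U -> V) : linear f -> f 0 = 0.
Proof.
by move=> lf; have := lf (-1) 0 0; rewrite scaler0 addr0 scaleN1r addNr.
Qed.

Section TensorLift.
Variables (K : fieldType) (U V W : lmodType K) (f : U -> V -> W).

Definition bilin := (forall v, linear (f^~ v)) /\ (forall u, linear (f u)).

Definition tlift0 (x : {malg K[(U * V)%type]}) : W :=
  \sum_(p <- msupp x) x@_p *: f p.1 p.2.

(* The linear map on U (x) V induced by f, meaningful when f is bilinear. *)
Definition tlift : U ⊗ V -> W :=
  locked_with tensor_key (fun t => tlift0 (trepr t)).

Lemma tlift0w (d : {fset (U * V)}) x : (msupp x `<=` d)%fset ->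
  tlift0 x = \sum_(p <- d) x@_p *: f p.1 p.2.
Proof.
move=> le; rewrite /tlift0 (big_fset_incl _ le) //= => p _ /mcoeff_outdom ->.
by rewrite scale0r.
Qed.

Lemma tlift0_linear : linear tlift0.
Proof.
move=> c x y.
pose d := (msupp x `|` msupp y)%fset.
rewrite (@tlift0w d x) ?fsubsetUl // (@tlift0w d y) ?fsubsetUr //.
rewrite (@tlift0w d); last first.
  apply: fsubset_trans (msuppD_le _ _) _.
  by apply: fsetSU; apply: msuppZ_le.
rewrite scaler_sumr -big_split /=; apply: eq_bigr => p _.
by rewrite mcoeffD mcoeffZ scalerDl scalerA.
Qed.

HB.instance Definition _ := GRing.isLinear.Build K _ W *:%R tlift0 tlift0_linear.

Lemma tlift0U p : tlift0 <<p>> = f p.1 p.2.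
Proof.
by rewrite (@tlift0w [fset p]%fset) ?msuppU_le // big_seq_fset1 mcoeffUU scale1r.
Qed.

Hypothesis f_bilin : bilin.

Lemma tlift_pi x : tlift (tpi x) = tlift0 x.
Proof.
rewrite /tlift unlock.
apply/eqP; rewrite -subr_eq0 -raddfB /=; apply/eqP.
have : tensor_rel (trepr (tpi x) - x) by apply/tpi_eq; rewrite treprK.
have [fl fr] := f_bilin.
elim=> [|c {}x y _ hx _ hy|c u u' v|c u v v'].
- by rewrite raddf0.
- by rewrite linearP /= hx hy scaler0 addr0.
- by rewrite raddfB /= tlift0_linear !tlift0U /= fl subrr.
- by rewrite raddfB /= tlift0_linear !tlift0U /= fr subrr.
Qed.

Lemma tlift_tens u v : tlift (u ⊗ v) = f u v.
Proof. by rewrite tensE tlift_pi tlift0U. Qed.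

Lemma tlift_linear : linear tlift.
Proof.
move=> c s t; rewrite -[s]treprK -[t]treprK -tpiZ -tpiD !tlift_pi.
exact: tlift0_linear.
Qed.

End TensorLift.

Lemma tensor_ext (K : fieldType) (U V W : lmodType K) (f g : U ⊗ V -> W) :
  linear f -> linear g -> (forall u v, f (u ⊗ v) = g (u ⊗ v)) -> f =1 g.
Proof.
move=> lf lg fg; elim/tens_ind=> [|c u v t IH].
  by rewrite (linear_map0 lf) (linear_map0 lg).
by rewrite lf lg fg IH.
Qed.

Section TensorMap.
Variables (K : fieldType) (U U' V V' : lmodType K).
Variables (f : {linear U -> U'}) (g : {linear V -> V'}).

Definition tmap : U ⊗ V -> U' ⊗ V' := tlift (fun u v => f u ⊗ g v).

Lemma tmap_bilin : bilin (fun u v => f u ⊗ g v).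
Proof.
split=> [v c u u'|u c v v'] /=; rewrite linearP.
  exact: tens_linl.
exact: tens_linr.
Qed.

Lemma tmap_tens u v : tmap (u ⊗ v) = f u ⊗ g v.
Proof. exact/tlift_tens/tmap_bilin. Qed.

HB.instance Definition _ :=
  GRing.isLinear.Build K (U ⊗ V)%type (U' ⊗ V')%type *:%R tmap (tlift_linear tmap_bilin).
End TensorMap.

Section TensorAssoc.
Variables (K : fieldType) (U V W : lmodType K).

Let assoc1 (w : W) : U ⊗ V -> U ⊗ (V ⊗ W) :=
  tlift (fun u v => u ⊗ (v ⊗ w)).

Let assoc1_bilin w : bilin (fun (u : U) (v : V) => u ⊗ (v ⊗ w) : U ⊗ (V ⊗ W)).
Proof.
split=> [v|u c v v']; first exact: tens_linl.
by rewrite tens_linl tens_linr.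
Qed.

Definition tassoc : (U ⊗ V) ⊗ W -> U ⊗ (V ⊗ W) := tlift (fun s w => assoc1 w s).

Lemma tassoc_bilin : bilin (fun s w => assoc1 w s).
Proof.
split=> [w|s c w w']; first exact/tlift_linear/assoc1_bilin.
elim/tens_ind: s => [|a u v t IH].
  have z x : assoc1 x 0 = 0 by exact: linear_map0 (tlift_linear (assoc1_bilin x)).
  by rewrite !z scaler0 addr0.
have e x :
    assoc1 x (a *: (u ⊗ v) + t) = a *: (u ⊗ (v ⊗ x)) + assoc1 x t.
  rewrite /assoc1 (tlift_linear (assoc1_bilin x)).
  by rewrite (tlift_tens (assoc1_bilin x)).
rewrite !e IH (tens_linr v c w w') (tens_linr u c (v ⊗ w) (v ⊗ w')).
by rewrite !scalerDr !scalerA [a * c]mulrC addrACA.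
Qed.

Lemma tassoc_tens u v w : tassoc ((u ⊗ v) ⊗ w) = u ⊗ (v ⊗ w).
Proof.
by rewrite /tassoc (tlift_tens tassoc_bilin) /assoc1 (tlift_tens (assoc1_bilin w)).
Qed.

HB.instance Definition _ :=
  GRing.isLinear.Build K ((U ⊗ V) ⊗ W)%type (U ⊗ (V ⊗ W))%type *:%R tassoc
    (tlift_linear tassoc_bilin).
End TensorAssoc.

Section TensorAlgebra.
Variables (K : fieldType) (A B : algType K).

Definition tmul1 (a : A) (b : B) : A ⊗ B -> A ⊗ B :=
  tlift (fun a' b' => (a * a') ⊗ (b * b')).

Lemma tmul1_bilin a b : bilin (fun (a' : A) (b' : B) => (a * a') ⊗ (b * b')).
Proof.
split=> [b' c x y|a' c x y].
  by rewrite mulrDr -scalerAr; apply: tens_linl.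
by rewrite mulrDr -scalerAr; apply: tens_linr.
Qed.

Definition tmul (s t : A ⊗ B) : A ⊗ B := tlift (fun a b => tmul1 a b t) s.

Lemma tmul1_linear a b : linear (tmul1 a b).
Proof. exact/tlift_linear/tmul1_bilin. Qed.

Lemma tmul1_tens a b a' b' : tmul1 a b (a' ⊗ b') = (a * a') ⊗ (b * b').
Proof. by rewrite /tmul1 (tlift_tens (tmul1_bilin a b)). Qed.

Lemma linear_comb (U V W : lmodType K) (f g h : U ⊗ V -> W) (c : K) :
    linear f -> linear g -> linear h ->
    (forall u v, f (u ⊗ v) = c *: g (u ⊗ v) + h (u ⊗ v)) ->
  forall t, f t = c *: g t + h t.
Proof.
move=> lf lg lh e; elim/tens_ind=> [|a u v t IH].
  by rewrite (linear_map0 lf) (linear_map0 lg) (linear_map0 lh) scaler0 addr0.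
by rewrite lf lg lh e IH !scalerDr !scalerA [a * c]mulrC addrACA.
Qed.

Lemma tmul_bilin0 t : bilin (fun a b => tmul1 a b t).
Proof.
split=> [b c x y|a c x y]; apply: linear_comb; try exact: tmul1_linear.
  by move=> u v; rewrite !tmul1_tens mulrDl -scalerAl; apply: tens_linl.
by move=> u v; rewrite !tmul1_tens mulrDl -scalerAl; apply: tens_linr.
Qed.

Lemma tmul_linl t : linear (tmul^~ t).
Proof. exact/tlift_linear/tmul_bilin0. Qed.

Lemma tmul_tensl a b t : tmul (a ⊗ b) t = tmul1 a b t.
Proof. by rewrite /tmul (tlift_tens (tmul_bilin0 t)). Qed.

Lemma tmul_tens a b a' b' : tmul (a ⊗ b) (a' ⊗ b') = (a * a') ⊗ (b * b').
Proof. by rewrite tmul_tensl tmul1_tens. Qed.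

Lemma tmul_linr s : linear (tmul s).
Proof.
move=> c x y; move: s; apply: linear_comb; try exact: tmul_linl.
by move=> u v; rewrite !tmul_tensl tmul1_linear.
Qed.

Lemma linear_comp (U V W : lmodType K) (f : U -> V) (g : V -> W) :
  linear f -> linear g -> linear (fun x => g (f x)).
Proof. by move=> lf lg c x y; rewrite lf lg. Qed.

Lemma linear_id (U : lmodType K) : linear (fun x : U => x).
Proof. by []. Qed.

Lemma tmulA : associative tmul.
Proof.
move=> x y z; move: x; apply: tensor_ext => [||a1 b1].
- exact: tmul_linl.
- exact: linear_comp (tmul_linl y) (tmul_linl z).
move: y; apply: tensor_ext => [||a2 b2].
- exact: linear_comp (tmul_linl z) (tmul_linr _).
- exact: linear_comp (tmul_linr _) (tmul_linl z).
move: z; apply: tensor_ext => [||a3 b3].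
- exact: linear_comp (tmul_linr _) (tmul_linr _).
- exact: tmul_linr.
by rewrite !tmul_tens !mulrA.
Qed.

Lemma tmul1t : left_id (1 ⊗ 1) tmul.
Proof.
apply: tensor_ext => [||a b]; [exact: tmul_linr | exact: linear_id |].
by rewrite tmul_tens !mul1r.
Qed.

Lemma tmult1 : right_id (1 ⊗ 1) tmul.
Proof.
apply: tensor_ext => [||a b]; [exact: tmul_linl | exact: linear_id |].
by rewrite tmul_tens !mulr1.
Qed.

Lemma tmulDl : left_distributive tmul +%R.
Proof. by move=> x y z; have := tmul_linl z 1 x y; rewrite !scale1r. Qed.

Lemma tmulDr : right_distributive tmul +%R.
Proof. by move=> z x y; have := tmul_linr z 1 x y; rewrite !scale1r. Qed.
End TensorAlgebra.

(* A linear form not vanishing at 1, needed for 1 (x) 1 != 0. *)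
Lemma exists_linear_form (K : fieldType) (A : algType K) :
  exists f : A -> K^o, linear f /\ f 1 = 1.
Proof.
pose P (S : set A) := (forall c x y, S x -> S y -> S (c *: x + y)) /\ ~ S 1.
have [F FP Ftot|M [[Mlin M1] Mmax]] := @Zorn_bigcup A P.
  split=> [c x y [X FX Xx] [Y FY Yy]|[X FX X1]]; last by have [] := FP X FX.
  have [XY|YX] := Ftot X Y FX FY.
    by exists Y => //; have [/(_ c x y) h _] := FP Y FY; apply: h => //; apply: XY.
  by exists X => //; have [/(_ c x y) h _] := FP X FX; apply: h => //; apply: YX.
have M0 : M 0.
  apply: contrapT => nM0.
  have Me x : ~ M x.
    by move=> Mx; apply: nM0; have := Mlin (-1) x x Mx Mx; rewrite scaleN1r addNr.
  apply: (Mmax [set 0]%classic); first by split=> [x /Me //|/(_ 0 erefl)].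
  split=> [c x y -> ->|/esym/eqP]; first by rewrite scaler0 addr0.
  by rewrite eq_sym oner_eq0.
have MZ c x : M x -> M (c *: x) by move=> Mx; rewrite -[_ *: _]addr0; apply: Mlin.
have MD x y : M x -> M y -> M (x + y).
  by move=> Mx My; rewrite -[x]scale1r; apply: Mlin.
have MN x : M x -> M (- x) by rewrite -scaleN1r; apply: MZ.
have ex a : exists c : K, M (a - c *: 1).
  have [Ma|nMa] := pselect (M a); first by exists 0; rewrite scale0r subr0.
  pose N := [set z | exists k x, M x /\ z = k *: a + x]%classic.
  have [k [x [Mx e]]] : N 1.
    apply: contrapT => N1; apply: (Mmax N); last first.
      split=> // c _ _ [k [x [Mx ->]]] [l [y [My ->]]].
      exists (c * k + l), (c *: x + y); split; first exact: Mlin.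
      by rewrite scalerDr scalerA addrACA -scalerDl.
    split=> [x Mx|]; first by exists 0, x; rewrite scale0r add0r.
    by move=> /(_ a) h; apply/nMa/h; exists 1, 0; rewrite scale1r addr0.
  have k0 : k != 0.
    by apply/eqP => k0; apply: M1; rewrite e k0 scale0r add0r.
  exists k^-1; rewrite e scalerDr scalerA mulVf // scale1r opprD addrA subrr.
  by rewrite add0r; apply/MN/MZ.
have uniq_c (c d : K) x : M (x - c *: 1) -> M (x - d *: 1) -> c = d.
  move=> Mc Md; apply: contrapT => /eqP cd; apply: M1.
  have dc : d - c != 0 by rewrite subr_eq0 eq_sym.
  have -> : 1 = (d - c)^-1 *: ((x - c *: 1) - (x - d *: 1)) :> A.
    rewrite opprB [X in _ *: X]addrC addrA subrK -scalerBl scalerA mulVf //.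
    by rewrite scale1r.
  exact/MZ/MD/MN.
have [f fP] := choice ex.
exists f; split; last by apply: uniq_c (fP 1) _; rewrite scale1r subrr.
move=> c x y; apply: uniq_c (fP _) _.
rewrite (_ : _ - _ = c *: (x - f x *: 1) + (y - f y *: 1)); first exact: Mlin.
by rewrite scalerBr scalerA addrACA -opprD -scalerDl.
Qed.

Lemma tensor1_neq0 (K : fieldType) (A B : algType K) : (1 : A) ⊗ (1 : B) != 0.
Proof.
have [f [lf f1]] := exists_linear_form A.
have [g [lg g1]] := exists_linear_form B.
have fg : bilin (fun a b => f a * g b : K^o).
  split=> [b c x y|a c x y]; first by rewrite lf mulrDl -scalerAl.
  by rewrite lg mulrDr scalerAr.
apply/eqP => /(congr1 (tlift (fun a b => f a * g b : K^o))).
rewrite (tlift_tens fg) f1 g1 mulr1 (linear_map0 (tlift_linear fg)).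
by apply/eqP; rewrite oner_eq0.
Qed.

HB.instance Definition _ (K : fieldType) (A B : algType K) :=
  GRing.Zmodule_isNzRing.Build (tensor A B)
    (@tmulA K A B) (@tmul1t K A B) (@tmult1 K A B)
    (@tmulDl K A B) (@tmulDr K A B) (tensor1_neq0 A B).

Section TensorAlgebraScale.
Variables (K : fieldType) (A B : algType K).

Lemma tmulZl (c : K) (s t : A ⊗ B) : c *: (s * t) = (c *: s) * t.
Proof.
have := tmul_linl t c s 0.
by rewrite addr0 (linear_map0 (tmul_linl t)) addr0 => /esym.
Qed.

Lemma tmulZr (c : K) (s t : A ⊗ B) : c *: (s * t) = s * (c *: t).
Proof.
have := tmul_linr s c t 0.
by rewrite addr0 (linear_map0 (tmul_linr s)) addr0 => /esym.
Qed.

HB.instance Definition _ := GRing.Lmodule_isLalgebra.Build K (tensor A B) tmulZl.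
HB.instance Definition _ := GRing.Lalgebra_isAlgebra.Build K (tensor A B) tmulZr.

Lemma tensM (a a' : A) (b b' : B) : (a ⊗ b) * (a' ⊗ b') = (a * a') ⊗ (b * b').
Proof. exact: tmul_tens. Qed.
End TensorAlgebraScale.

Section Bialgebra.
Variables (K : fieldType) (A : algType K).
Variables (Delta : {lrmorphism A -> A ⊗ A}) (eps : {lrmorphism A -> K^o}).

Definition coassociative :=
  forall x, tassoc (tmap Delta idfun (Delta x)) = tmap idfun Delta (Delta x).

Definition left_counital :=
  forall x, tlift (fun a b => eps a *: b) (Delta x) = x.

Definition right_counital :=
  forall x, tlift (fun a b => eps b *: a) (Delta x) = x.

Definition is_bialgebra : Prop :=
  [/\ coassociative, left_counital & right_counital].
End Bialgebra.

Definition is_bialgebra_morphism (K : fieldType) (A B : algType K)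
    (DeltaA : {lrmorphism A -> A ⊗ A}) (epsA : {lrmorphism A -> K^o})
    (DeltaB : {lrmorphism B -> B ⊗ B}) (epsB : {lrmorphism B -> K^o})
    (f : {lrmorphism A -> B}) : Prop :=
  (forall x, DeltaB (f x) = tmap f f (DeltaA x)) /\
  (forall x, epsB (f x) = epsA x).

(* The monoid algebra of the free monoid on I. *)
Definition freealg (K : fieldType) (I : choiceType) : Type :=
  {malg K[{fmonom I}]}.

Section FreeAlgebra.
Variables (K : fieldType) (I : choiceType).

HB.instance Definition _ := GRing.Lalgebra.on (freealg K I).

Lemma freealgZr (c : K) (x y : freealg K I) : c *: (x * y) = x * (c *: y).
Proof.
have central z : z * c%:MP = c *: z :> {malg K[{fmonom I}]}.
  rewrite malgM_def fgmulgU malgZ_def; apply: eq_bigr => k _.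
  by rewrite mulm1 mulrC.
have e : x * (c%:MP * y) = x * c%:MP * y by rewrite mulrA.
by rewrite -[c *: y]mul_malgC [RHS]e central scalerAl.
Qed.

HB.instance Definition _ := GRing.Lalgebra_isAlgebra.Build K (freealg K I) freealgZr.

Definition fgen (i : I) : freealg K I := << fmu i >>.

Section Lift.
Variables (A : algType K) (f : I -> A).

Definition fword (w : {fmonom I}) : A := \prod_(i <- w) f i.

Lemma fword_mmorphism : mmorphism fword.
Proof. by split=> [w w'|]; rewrite /fword ?fm1 ?big_nil // fmM big_cat. Qed.

HB.instance Definition _ := isMultiplicative.Build _ A fword fword_mmorphism.

(* The unique algebra morphism sending each generator fgen i to f i. *)
Definition flift : freealg K I -> A := mmap (in_alg A) fword.

Lemma flift_gen i : flift (fgen i) = f i.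
Proof. by rewrite /flift mmapU /= scale1r mul1r /fword fmU big_seq1. Qed.

Lemma flift_linear : linear flift.
Proof.
move=> c x y; rewrite /flift raddfD /= mmapZ /=.
by rewrite -scalerAl mul1r.
Qed.

Lemma flift_multiplicative : monoid_morphism flift.
Proof.
have [g m m'|h1 h2] := @commr_mmap_is_multiplicative _ _ _ (in_alg A) fword.
  by rewrite /GRing.comm /= -scalerAl mul1r -scalerAr mulr1.
by split.
Qed.

HB.instance Definition _ := GRing.isLinear.Build K _ A *:%R flift flift_linear.
HB.instance Definition _ :=
  GRing.isMonoidMorphism.Build _ A flift flift_multiplicative.
End Lift.
End FreeAlgebra.

Section GeneratedSubalgebra.
Variables (K : fieldType) (A : algType K) (S : A -> Prop).

Inductive generated : A -> Prop :=
| generated_in x : S x -> generated x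
| generated1 : generated 1
| generatedD c x y : generated x -> generated y -> generated (c *: x + y)
| generatedM x y : generated x -> generated y -> generated (x * y).

Definition in_generated : pred A := fun x => `[< generated x >].

Lemma in_generated_subalg : GRing.subsemialg_closed in_generated.
Proof.
have g0 : generated 0.
  by rewrite -(addNr 1) -scaleN1r; apply: generatedD; apply: generated1.
split; first by apply/asboolP; apply: generated1.
- split=> [|x y /asboolP hx /asboolP hy]; apply/asboolP; first exact: g0.
  by rewrite -[x]scale1r; apply: generatedD.
- by move=> c x /asboolP hx; apply/asboolP; rewrite -[_ *: _]addr0; apply: generatedD.
- by move=> x y /asboolP hx /asboolP hy; apply/asboolP; apply: generatedM.
Qed.

Record subalgebra : Type :=
  Subalgebra { subalg_val : A; subalg_valP : in_generated subalg_val }.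

HB.instance Definition _ := [isSub for subalg_val].
HB.instance Definition _ := [Choice of subalgebra by <:].
HB.instance Definition _ :=
  GRing.SubChoice_isSubAlgebra.Build K A in_generated subalgebra
    in_generated_subalg.

Lemma subalg_val_linear : linear subalg_val.
Proof. by []. Qed.

Lemma subalg_val_multiplicative : monoid_morphism subalg_val.
Proof. by []. Qed.

HB.instance Definition _ :=
  GRing.isLinear.Build K subalgebra A *:%R subalg_val subalg_val_linear.
HB.instance Definition _ :=
  GRing.isMonoidMorphism.Build subalgebra A subalg_val subalg_val_multiplicative.

Definition subalg_incl : {lrmorphism subalgebra -> A} := subalg_val.
End GeneratedSubalgebra.

Section BialgebraT.
Variable K : fieldType.

(* Generators indexed by bool: true for g, false for h. *)
Definition Talg : algType K := freealg K bool.

Definition Tg : Talg := fgen K true.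
Definition Th : Talg := fgen K false.

Definition TDelta : {lrmorphism Talg -> Talg ⊗ Talg} :=
  flift (fun x : bool => if x then Tg ⊗ Tg else 1 ⊗ Th + Th ⊗ Tg).

Definition Teps : {lrmorphism Talg -> K^o} :=
  flift (fun x : bool => if x then 1 else 0 : K^o).

Definition omega (n : nat) : Talg := Tg * Th ^+ n.

Definition is_omega (x : Talg) : Prop := exists n, x = omega n.

Definition Lalg : algType K := subalgebra is_omega.

Definition Lincl : {lrmorphism Lalg -> Talg} := subalg_incl is_omega.
End BialgebraT.

Section FaaDiBruno.
Variable K : fieldType.

Definition FdBalg : algType K := freealg K nat.

Definition FdBa (n : nat) : FdBalg := fgen K n.

(* The indices i_0, ..., i_k, of sum n - k, are bounded by n - k: they are
   functions from {0, ..., k} to {0, ..., n - k}. *)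
Definition FdBDelta_gen (n : nat) : (FdBalg ⊗ FdBalg)%type :=
  \sum_(k < n.+1)
    FdBa k ⊗ (\sum_(i : {ffun 'I_k.+1 -> 'I_(n - k).+1}
                     | (\sum_(j < k.+1) i j == n - k)%N)
                \prod_(j < k.+1) FdBa (i j)).

Definition FdBDelta : {lrmorphism FdBalg -> FdBalg ⊗ FdBalg} :=
  flift FdBDelta_gen.

Definition FdBeps : {lrmorphism FdBalg -> K^o} :=
  flift (fun n : nat => (n == 0%N)%:R : K^o).
End FaaDiBruno.

(* Main.v *)
Require Import Defs.
From HB Require Import structures.
From mathcomp Require Import all_boot all_algebra.
From mathcomp Require Import finmap monalg boolp.

Set Implicit Arguments.
Unset Strict Implicit.
Unset Printing Implicit Defensive.

Import GRing.Theory.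
Local Open Scope ring_scope.

(** Write [T] for the free algebra on [g], [h], and let [psi] be the algebra
    morphism from the free algebra on the [a_n] to [T] that sends [a_n] to
    [omega_n = g h^n]; it is [FdB_to_T] below.  Everything follows from four
    properties of [psi].

    The image of [psi] is [L], by definition of a generated subalgebra.

    [psi] has a linear left inverse.  It sends a word [a_n1 ... a_nr] to the
    word [g h^n1 ... g h^nr], from which the exponents [n1, ..., nr] can be read
    off: each letter [g] opens a new factor.  Reading off the exponents of basis
    words and extending linearly gives the left inverse ([FdB_to_TK]).  Hence
    [psi] is an isomorphism onto [L], and a linear left inverse, unlike mere
    injectivity, passes to tensor powers of [psi] for free.

    [psi] commutes with the coproducts ([FdB_to_T_Delta]).  On generators, let
    [S(k, m)] be the sum of [omega_i1 ... omega_ik] over [i1 + ... + ik = m],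
    which is the coefficient of [X^m] in the [k]-th power of the series
    [sum_i omega_i X^i] with a central variable [X].  Splitting off the last
    letter of the last factor, which is [g] if [ik = 0] and [h] otherwise, gives
    [S(k+1, m+1) = S(k, m+1) g + S(k+1, m) h].  Expanding
    [(g (x) g) (1 (x) h + h (x) g)^n] one factor at a time yields the same
    recursion, so that [Delta(omega_n) = sum_k omega_k (x) S(k+1, n-k)]
    ([TDelta_omega]), which is the Faa di Bruno coproduct.  The
    counits agree because [eps(g) = 1] and [eps(h) = 0].

    [T] is a bialgebra.  Both sides of each axiom are algebra morphisms on a
    free algebra, so that they are compared on [g] and [h] ([T_bialgebra]).

    The axioms are equations between linear maps, and they descend along a
    morphism whose tensor powers are injective ([bialgebra_split_mono]): applied
    to [psi], this makes the Faa di Bruno algebra a bialgebra; the coproduct of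
    [L] is the one carried over by the isomorphism, and the same lemma, applied
    to the inclusion of [L] in [T], shows that it is a bialgebra structure. *)

(** * Algebra morphisms on tensor products *)

Lemma mulr_linear (K : fieldType) (A : algType K) (a : A) : linear ( *%R a).
Proof. by move=> c x y; rewrite mulrDr -scalerAr. Qed.

Lemma mull_linear (K : fieldType) (A : algType K) (a : A) : linear ( *%R^~ a).
Proof. by move=> c x y; rewrite mulrDl -scalerAl. Qed.

Lemma tensDr (K : fieldType) (U V : lmodType K) (u : U) (v w : V) :
  u ⊗ (v + w) = u ⊗ v + u ⊗ w.
Proof. by have := tens_linr u 1 v w; rewrite !scale1r. Qed.

Lemma tensDl (K : fieldType) (U V : lmodType K) (u v : U) (w : V) :
  (u + v) ⊗ w = u ⊗ w + v ⊗ w.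
Proof. by have := tens_linl w 1 u v; rewrite !scale1r. Qed.

Section TensorMorphisms.
Variables (K : fieldType) (A B C : algType K).

(** A linear map on a tensor product is multiplicative as soon as it is so on
    pure tensors, because both sides of [F (s * t) = F s * F t] are linear in
    each of [s] and [t]. *)
Lemma tensor_monoid_morphism (F : A ⊗ B -> C) :
    linear F -> F (1 ⊗ 1) = 1 ->
    (forall a b a' b', F ((a * a') ⊗ (b * b')) = F (a ⊗ b) * F (a' ⊗ b')) ->
  monoid_morphism F.
Proof.
move=> lF F1 FM; split=> // s t.
move: s; apply: tensor_ext => [||a b].
- exact: linear_comp (mull_linear t) lF.
- exact: linear_comp lF (mull_linear (F t)).
move: t; apply: tensor_ext => [||a' b'].
- exact: linear_comp (mulr_linear (a ⊗ b)) lF.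
- exact: linear_comp lF (mulr_linear (F (a ⊗ b))).
by rewrite tensM FM.
Qed.
End TensorMorphisms.

Section TmapMorphism.
Variables (K : fieldType) (A A' B B' : algType K).
Variables (f : {lrmorphism A -> A'}) (g : {lrmorphism B -> B'}).

Lemma tmap_monoid_morphism : monoid_morphism (tmap f g).
Proof.
apply: tensor_monoid_morphism => [||a b a' b']; first exact: linearP.
  by rewrite tmap_tens !rmorph1.
by rewrite !tmap_tens !rmorphM tensM.
Qed.

HB.instance Definition _ := GRing.isMonoidMorphism.Build
  (tensor A B) (tensor A' B') (tmap f g) tmap_monoid_morphism.
End TmapMorphism.

Section TassocMorphism.
Variables (K : fieldType) (A B C : algType K).

Lemma tassoc_monoid_morphism : monoid_morphism (@tassoc K A B C).
Proof.
have tA := @tassoc_tens K A B C.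
have lA : linear (@tassoc K A B C) by exact: linearP.
apply: tensor_monoid_morphism => // [|s c s' c']; first by rewrite tA.
have ll (D E : lmodType K) (y : E) : linear (fun x : D => x ⊗ y).
  exact: tens_linl.
move: s; apply: tensor_ext => [||a b].
- exact: linear_comp (linear_comp (mull_linear s') (ll _ _ _)) lA.
- exact: linear_comp (linear_comp (ll _ _ _) lA) (mull_linear _).
move: s'; apply: tensor_ext => [||a' b'].
- exact: linear_comp (linear_comp (mulr_linear _) (ll _ _ _)) lA.
- exact: linear_comp (linear_comp (ll _ _ _) lA) (mulr_linear _).
by rewrite tensM !tA !tensM.
Qed.

HB.instance Definition _ := GRing.isMonoidMorphism.Build
  (tensor (tensor A B) C) (tensor A (tensor B C)) (@tassoc K A B C)
  tassoc_monoid_morphism.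
End TassocMorphism.

Section Counits.
Variables (K : fieldType) (A : algType K) (eps : {lrmorphism A -> K^o}).

(** These are the maps [eps (x) id] and [id (x) eps] of the counit axioms, up to
    the identification of [K (x) A] and [A (x) K] with [A]. *)
Definition counit_left : A ⊗ A -> A := tlift (fun a b => eps a *: b).
Definition counit_right : A ⊗ A -> A := tlift (fun a b => eps b *: a).

Lemma counit_left_bilin : bilin (fun a b : A => eps a *: b).
Proof.
split=> [b c x y|a c x y]; last by rewrite scalerDr !scalerA [_ * c]mulrC.
by rewrite linearP scalerDl scalerA.
Qed.

Lemma counit_right_bilin : bilin (fun a b : A => eps b *: a).
Proof. by have [l r] := counit_left_bilin; split=> b; [apply: r | apply: l]. Qed.

Lemma counit_left_tens a b : counit_left (a ⊗ b) = eps a *: b.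
Proof. exact: (tlift_tens counit_left_bilin). Qed.

Lemma counit_right_tens a b : counit_right (a ⊗ b) = eps b *: a.
Proof. exact: (tlift_tens counit_right_bilin). Qed.

Lemma counit_left_linear : linear counit_left.
Proof. exact/tlift_linear/counit_left_bilin. Qed.

Lemma counit_right_linear : linear counit_right.
Proof. exact/tlift_linear/counit_right_bilin. Qed.

Lemma counit_left_monoid_morphism : monoid_morphism counit_left.
Proof.
apply: tensor_monoid_morphism => [||a b a' b']; first exact: counit_left_linear.
  by rewrite counit_left_tens rmorph1 scale1r.
by rewrite !counit_left_tens rmorphM -scalerAl -scalerAr scalerA.
Qed.

Lemma counit_right_monoid_morphism : monoid_morphism counit_right.
Proof.
apply: tensor_monoid_morphism => [||a b a' b']; first exact: counit_right_linear.
  by rewrite counit_right_tens rmorph1 scale1r.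
by rewrite !counit_right_tens rmorphM -scalerAl -scalerAr scalerA.
Qed.

HB.instance Definition _ := GRing.isLinear.Build K (tensor A A) A *:%R
  counit_left counit_left_linear.
HB.instance Definition _ := GRing.isMonoidMorphism.Build (tensor A A) A
  counit_left counit_left_monoid_morphism.
HB.instance Definition _ := GRing.isLinear.Build K (tensor A A) A *:%R
  counit_right counit_right_linear.
HB.instance Definition _ := GRing.isMonoidMorphism.Build (tensor A A) A
  counit_right counit_right_monoid_morphism.
End Counits.

(** * Functoriality of tensor products and descent of bialgebras *)

Section TensorFunctor.
Variable K : fieldType.

(** The tensor product is functorial; this form, for a pair of commutative
    squares, spares the intermediate rewriting with composites. *)
Lemma tmap_square (U V W X U' V' W' X' : lmodType K)
    (f : {linear U -> V}) (g : {linear V -> X})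
    (h : {linear U -> W}) (k : {linear W -> X})
    (f' : {linear U' -> V'}) (g' : {linear V' -> X'})
    (h' : {linear U' -> W'}) (k' : {linear W' -> X'}) :
    (forall u, g (f u) = k (h u)) -> (forall u, g' (f' u) = k' (h' u)) ->
  forall t, tmap g g' (tmap f f' t) = tmap k k' (tmap h h' t).
Proof.
move=> e e'; apply: tensor_ext => [||u u']; last by rewrite !tmap_tens e e'.
  exact: (@linearP _ _ _ _ (tmap g g' \o tmap f f')).
exact: (@linearP _ _ _ _ (tmap k k' \o tmap h h')).
Qed.

Lemma tmapK (U V U' V' : lmodType K) (f : {linear U -> V}) (g : {linear V -> U})
    (f' : {linear U' -> V'}) (g' : {linear V' -> U'}) :
  cancel f g -> cancel f' g' -> cancel (tmap f f') (tmap g g').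
Proof.
move=> fK fK'; apply: tensor_ext => [||u u'].
- exact: (@linearP _ _ _ _ (tmap g g' \o tmap f f')).
- exact: linear_id.
by rewrite !tmap_tens fK fK'.
Qed.

Lemma tassoc_natural (U V W U' V' W' : lmodType K)
    (f : {linear U -> U'}) (g : {linear V -> V'}) (h : {linear W -> W'}) t :
  tmap f (tmap g h) (tassoc t) = tassoc (tmap (tmap f g) h t).
Proof.
have ll := @linearP _ _ _ _ (tmap f (tmap g h) \o @tassoc K U V W).
have lr := @linearP _ _ _ _ (@tassoc K U' V' W' \o tmap (tmap f g) h).
move: t; apply: tensor_ext => [||t w]; [exact: ll | exact: lr |].
move: t; apply: tensor_ext => [||u v].
- exact: linear_comp (tens_linl w) ll.
- exact: linear_comp (tens_linl w) lr.
by rewrite tassoc_tens !tmap_tens /= !tmap_tens tassoc_tens.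
Qed.
End TensorFunctor.

Section Transfer.
Variables (K : fieldType) (A B : algType K).
Variables (DA : {lrmorphism A -> A ⊗ A}) (epsA : {lrmorphism A -> K^o}).
Variables (DB : {lrmorphism B -> B ⊗ B}) (epsB : {lrmorphism B -> K^o}).
Variables (f : {lrmorphism A -> B}) (r : {linear B -> A}).

Hypothesis fK : cancel f r.
Hypothesis f_mor : is_bialgebra_morphism DA epsA DB epsB f.
Hypothesis B_bialg : is_bialgebra DB epsB.

(** Each axiom for [A] is tested after applying [f], or its third tensor power,
    which is injective because [r] splits it; there it becomes the axiom for
    [B]. *)
Lemma bialgebra_split_mono : is_bialgebra DA epsA.
Proof.
have [fD fe] := f_mor; have [Bco Bl Br] := B_bialg.
have injf : injective f := can_inj fK.
split=> x.
- apply: (can_inj (tmapK fK (tmapK fK fK))).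
  rewrite tassoc_natural.
  rewrite (@tmap_square _ _ _ _ _ _ _ _ _ DA (tmap f f) f DB idfun f f idfun
    (fun u => esym (fD u)) (frefl _)).
  rewrite (@tmap_square _ _ _ _ _ _ _ _ _ idfun f f idfun DA (tmap f f) f DB
    (frefl _) (fun u => esym (fD u))).
  by rewrite -fD Bco.
- rewrite -/(counit_left epsA _); apply: injf.
  rewrite -[RHS]Bl fD -/(counit_left epsB _).
  move: (DA x); apply: tensor_ext => [||a b].
  + exact: (@linearP _ _ _ _ (f \o counit_left epsA)).
  + exact: (@linearP _ _ _ _ (counit_left epsB \o tmap f f)).
  by rewrite tmap_tens !counit_left_tens linearZ /= fe.
- rewrite -/(counit_right epsA _); apply: injf.
  rewrite -[RHS]Br fD -/(counit_right epsB _).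
  move: (DA x); apply: tensor_ext => [||a b].
  + exact: (@linearP _ _ _ _ (f \o counit_right epsA)).
  + exact: (@linearP _ _ _ _ (counit_right epsB \o tmap f f)).
  by rewrite tmap_tens !counit_right_tens linearZ /= fe.
Qed.
End Transfer.

(** * Free algebras *)

Section FreeAlgebraExt.
Variables (K : fieldType) (I : choiceType).

Definition fwordU (s : seq I) : freealg K I := << FMonom s >>.

Lemma fwordU_cat s t : fwordU (s ++ t) = fwordU s * fwordU t.
Proof.
rewrite /fwordU [RHS]malgM_def fgmulUU mulr1; congr << _ >>.
by apply/eqP; rewrite fmP fmM.
Qed.

Lemma fwordU0 : fwordU [::] = 1.
Proof. by congr << _ >>; apply/eqP; rewrite fmP fm1. Qed.

Lemma fwordU1 i : fwordU [:: i] = fgen K i.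
Proof. by congr << _ >>; apply/eqP; rewrite fmP fmU. Qed.

Lemma fwordUE s : fwordU s = \prod_(i <- s) fgen K i.
Proof.
elim: s => [|i s IH]; first by rewrite big_nil fwordU0.
by rewrite big_cons -IH -cat1s fwordU_cat fwordU1.
Qed.

Lemma freealg_ind (P : freealg K I -> Prop) :
  P 0 -> (forall c s x, P x -> P (c *: fwordU s + x)) -> forall x, P x.
Proof.
move=> P0 PD x; rewrite [x]monalgE.
elim: (X in \sum_(k <- X) _) => [|w s IH]; first by rewrite big_nil.
rewrite big_cons; set y := \sum_(_ <- _) _ in IH *.
suff -> : << x@_w *g w >> = x@_w *: fwordU w by apply: PD.
rewrite /fwordU fmK.
by apply/malgP => k; rewrite mcoeffZ !mcoeffU mulr_natr.
Qed.

Lemma freealg_ext_linear (V : lmodType K) (f g : {linear freealg K I -> V}) :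
  (forall s, f (fwordU s) = g (fwordU s)) -> f =1 g.
Proof.
move=> fg; elim/freealg_ind => [|c s x IH]; first by rewrite !linear0.
by rewrite !linearP fg IH.
Qed.

Lemma freealg_ext (A : algType K) (f g : {lrmorphism freealg K I -> A}) :
  (forall i, f (fgen K i) = g (fgen K i)) -> f =1 g.
Proof.
move=> fg; apply: freealg_ext_linear => s; rewrite fwordUE.
rewrite (rmorph_prod f) (rmorph_prod g).
by apply: eq_bigr => i _; apply: fg.
Qed.

Section LinearLift.
Variables (A : algType K) (h : {fmonom I} -> A).

(** Basis words can be sent anywhere by a linear map: in contrast to [flift],
    [h] need not be compatible with concatenation. *)
Definition flinlift : freealg K I -> A := mmap (in_alg A) h.

Lemma flinlift_linear : linear flinlift.
Proof.
move=> c x y; rewrite /flinlift raddfD /=; congr (_ + _).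
rewrite (mmapEw (msuppZ_le c x)) mmapE scaler_sumr; apply: eq_bigr => w _.
by rewrite mcoeffZ /= -scalerA -scalerAl.
Qed.

HB.instance Definition _ :=
  GRing.isLinear.Build K (freealg K I) A *:%R flinlift flinlift_linear.

Lemma flinlift_word s : flinlift (fwordU s) = h (FMonom s).
Proof. by rewrite /flinlift mmapU /= scale1r mul1r. Qed.
End LinearLift.
End FreeAlgebraExt.

(** * Sums over compositions of an integer *)

Section Compositions.
Variables (R : nzRingType) (a : nat -> R).

(** The sum of [a i1 * ... * a ik] over [i1 + ... + ik = m], defined as a
    coefficient of the [k]-th power of the generating series of [a].  The series
    is truncated after degree [m], which leaves this coefficient unchanged and
    makes it a polynomial. The power gives the recursion on [k]
    ([composition_sumS]) as well as the explicit sum ([composition_sumE]). *)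
Definition composition_sum (k m : nat) : R := ((\poly_(i < m.+1) a i) ^+ k)`_m.

Lemma coef_exp_eq (p q : {poly R}) m :
    (forall i, (i <= m)%N -> p`_i = q`_i) ->
  forall k i, (i <= m)%N -> (p ^+ k)`_i = (q ^+ k)`_i.
Proof.
move=> pq; elim=> [|k IH] i im; first by rewrite !expr0.
rewrite !exprS !coefM; apply: eq_bigr => j _.
by rewrite pq ?IH // ?(leq_trans _ im) ?leq_subr // -ltnS.
Qed.

Lemma composition_sum_trunc k n m : (m < n)%N ->
  ((\poly_(i < n) a i) ^+ k)`_m = composition_sum k m.
Proof.
move=> mn; apply: (@coef_exp_eq _ _ m) => // i im.
by rewrite !coef_poly ltnS im (leq_ltn_trans im mn).
Qed.

Lemma composition_sumS k m : composition_sum k.+1 m =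
  \sum_(i < m.+1) composition_sum k (m - i) * a i.
Proof.
rewrite [LHS]/composition_sum exprSr coefMr; apply: eq_bigr => i _.
by rewrite coef_poly ltn_ord composition_sum_trunc // ltnS leq_subr.
Qed.

Lemma composition_sum1 m : composition_sum 1 m = a m.
Proof. by rewrite /composition_sum expr1 coef_poly ltnSn. Qed.

(** Although [R] is not commutative, the variable is central, so that the powers
    of ['X] can be collected without changing the order of the [x j]. *)
Lemma prod_monomials k (x : 'I_k -> R) (e : 'I_k -> nat) :
  \prod_j (x j *: 'X^(e j)) = (\prod_j x j) *: 'X^(\sum_j e j) :> {poly R}.
Proof.
elim: k x e => [|k IH] x e; first by rewrite !big_ord0 expr0 scale1r.
rewrite !big_ord_recl IH -scalerAl exprD -!mul_polyC !mulrA; congr (_ * _).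
by rewrite polyCM -!mulrA; congr (_ * _); rewrite commr_polyXn.
Qed.

Lemma composition_sumE k m : composition_sum k m =
  \sum_(i : {ffun 'I_k -> 'I_m.+1} | (\sum_(j < k) i j == m)%N)
     \prod_(j < k) a (i j).
Proof.
rewrite /composition_sum poly_def -[X in _ ^+ X]card_ord -prodr_const.
(* Expand the product of [k] sums over all choices of one term in each. *)
rewrite bigA_distr_bigA coef_sum [RHS]big_mkcond /=; apply: eq_bigr => i _.
rewrite prod_monomials coefZ coefXn [(m == _)%N]eq_sym.
by case: eqP => _; rewrite ?mulr1 ?mulr0.
Qed.
End Compositions.

(** In a product of [k.+1] factors [g * h ^+ i] of total exponent [m.+1], the
    last letter is [g] if the last exponent vanishes, and [h] otherwise. *)
Lemma composition_sum_geom (R : nzRingType) (g h : R) k m :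
  composition_sum (fun i => g * h ^+ i) k.+1 m.+1 =
  composition_sum (fun i => g * h ^+ i) k m.+1 * g +
  composition_sum (fun i => g * h ^+ i) k.+1 m * h.
Proof.
rewrite !composition_sumS big_ord_recl subn0 expr0 mulr1; congr (_ + _).
rewrite mulr_suml; apply: eq_bigr => i _.
by rewrite lift0 subSS exprSr !mulrA.
Qed.

(** * The bialgebra on g and h *)

Section FdBInT.
Variable K : fieldType.
Local Notation T := (Talg K).
Local Notation g := (Tg K).
Local Notation h := (Th K).

Lemma TDelta_g : TDelta K g = g ⊗ g. Proof. by rewrite /= flift_gen. Qed.
Lemma TDelta_h : TDelta K h = 1 ⊗ h + h ⊗ g. Proof. by rewrite /= flift_gen. Qed.
Lemma TDelta_1 : TDelta K 1 = 1 ⊗ 1. Proof. exact: rmorph1. Qed.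
Lemma Teps_g : Teps K g = 1. Proof. by rewrite /= flift_gen. Qed.
Lemma Teps_h : Teps K h = 0. Proof. by rewrite /= flift_gen. Qed.

Lemma T_bialgebra : is_bialgebra (TDelta K) (Teps K).
Proof.
set D := TDelta K; set e := Teps K.
have tassocD x y : @tassoc K T T T (x + y) = tassoc x + tassoc y.
  exact: linearD.
have tmapD (U V U' V' : lmodType K) (f : {linear U -> V})
    (f' : {linear U' -> V'}) x y : tmap f f' (x + y) = tmap f f' x + tmap f f' y.
  exact: linearD.
split.
- apply: (@freealg_ext K bool _ (@tassoc K T T T \o tmap D idfun \o D)
           (tmap idfun D \o D)) => -[].
    change (tassoc (tmap D idfun (D g)) = tmap idfun D (D g)).
    by rewrite TDelta_g !tmap_tens /= TDelta_g tassoc_tens.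
  change (tassoc (tmap D idfun (D h)) = tmap idfun D (D h)).
  rewrite TDelta_h !tmapD !tmap_tens /= -/D TDelta_h TDelta_g TDelta_1.
  rewrite [in LHS]tensDl !tassocD tensDr !tassoc_tens.
  by rewrite addrA.
- apply: (@freealg_ext K bool _ (counit_left e \o D) idfun) => -[].
    change (counit_left e (D g) = g).
    by rewrite TDelta_g counit_left_tens Teps_g scale1r.
  change (counit_left e (D h) = h).
  have eD x y : counit_left e (x + y) = counit_left e x + counit_left e y.
    exact: linearD.
  by rewrite TDelta_h eD !counit_left_tens Teps_h rmorph1 scale1r scale0r addr0.
- apply: (@freealg_ext K bool _ (counit_right e \o D) idfun) => -[].
    change (counit_right e (D g) = g).
    by rewrite TDelta_g counit_right_tens Teps_g scale1r.
  change (counit_right e (D h) = h).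
  have eD x y : counit_right e (x + y) = counit_right e x + counit_right e y.
    exact: linearD.
  by rewrite TDelta_h eD !counit_right_tens Teps_h Teps_g scale1r scale0r add0r.
Qed.

(** This is the Faa di Bruno coproduct in terms of the [omega n].  By induction on
    [n]: multiplying the [k]-th term on the right by [1 ⊗ h + h ⊗ g] contributes
    to the [k]-th and [k.+1]-th terms of the next sum, as prescribed by
    [composition_sum_geom]. *)
Lemma TDelta_omega n : TDelta K (omega K n) =
  \sum_(k < n.+1) omega K k ⊗ composition_sum (omega K) k.+1 (n - k).
Proof.
pose S := composition_sum (omega K).
have S0 k : S k.+1 0%N = S k 0%N * g.
  by rewrite /S composition_sumS big_ord1 /omega expr0 mulr1.
have SS k m : S k.+1 m.+1 = S k m.+1 * g + S k.+1 m * h.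
  exact: composition_sum_geom.
have S1 m : S 1%N m = omega K m by exact: composition_sum1.
have omegaS m : omega K m * h = omega K m.+1 by rewrite /omega exprSr mulrA.
rewrite -(big_mkord xpredT (fun k => omega K k ⊗ S k.+1 (n - k)%N)).
elim: n => [|n IH].
  by rewrite big_nat1 S1 /omega !expr0 !mulr1 TDelta_g.
have -> : TDelta K (omega K n.+1) = TDelta K (omega K n) * TDelta K h.
  by rewrite -omegaS; exact: rmorphM.
rewrite IH TDelta_h mulr_suml.
under [LHS]eq_bigr => k _ do rewrite mulrDr !tensM mulr1 omegaS.
(* The two sums are offset by one: the term [k = 0] of the result comes from
   [1 ⊗ h] alone, and its term [k = n.+1] from [h ⊗ g] alone. *)
rewrite big_split [RHS]big_nat_recl //.
rewrite [X in X + _ = _]big_nat_recl // -addrA !subn0 !S1 omegaS.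
congr (_ + _).
rewrite [X in _ + X = _]big_nat_recr // [RHS]big_nat_recr //= addrA !subnn -S0.
congr (_ + _).
rewrite -big_split; apply: eq_big_nat => i /andP [_ lt_in].
have e1 : (n - i)%N = (n - i.+1).+1 by rewrite subnSK.
by rewrite subSS e1 [S i.+2 _.+1]SS tensDr addrC.
Qed.

(** * The embedding of the Faa di Bruno bialgebra *)

Definition FdB_to_T : {lrmorphism FdBalg K -> T} := flift (omega K).

Lemma FdB_to_T_gen n : FdB_to_T (FdBa K n) = omega K n.
Proof. exact: flift_gen. Qed.

Lemma FdB_to_T_Delta x :
  TDelta K (FdB_to_T x) = tmap FdB_to_T FdB_to_T (FdBDelta K x).
Proof.
apply: (@freealg_ext K nat _ (TDelta K \o FdB_to_T)
          (tmap FdB_to_T FdB_to_T \o FdBDelta K)) => n.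
change (TDelta K (FdB_to_T (FdBa K n)) =
  tmap FdB_to_T FdB_to_T (FdBDelta K (FdBa K n))).
rewrite FdB_to_T_gen TDelta_omega.
have -> : FdBDelta K (FdBa K n) = FdBDelta_gen K n by exact: flift_gen.
rewrite /FdBDelta_gen (linear_sum (tmap FdB_to_T FdB_to_T)) /=.
apply: eq_bigr => k _.
rewrite tmap_tens; congr (_ ⊗ _); first by rewrite -FdB_to_T_gen.
rewrite composition_sumE (linear_sum FdB_to_T); apply: eq_bigr => i _.
rewrite (rmorph_prod FdB_to_T); apply: eq_bigr => j _.
by rewrite -FdB_to_T_gen.
Qed.

Lemma FdB_to_T_eps x : Teps K (FdB_to_T x) = FdBeps K x.
Proof.
apply: (@freealg_ext K nat _ (Teps K \o FdB_to_T) (FdBeps K)) => n.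
change (Teps K (FdB_to_T (FdBa K n)) = FdBeps K (FdBa K n)).
have -> : FdBeps K (FdBa K n) = (n == 0%N)%:R by exact: flift_gen.
rewrite FdB_to_T_gen; have -> : Teps K (omega K n) = Teps K g * Teps K h ^+ n.
  by rewrite -rmorphXn -rmorphM.
by rewrite Teps_g Teps_h mul1r expr0n.
Qed.

Definition omega_word (v : seq nat) : seq bool :=
  flatten [seq true :: nseq n false | n <- v].

(** Reads a word as [h^p] followed by [g h^n1 ... g h^nr], with result
    [(p, [:: n1; ...; nr])]. *)
Fixpoint decode (w : seq bool) : nat * seq nat :=
  match w with
  | [::] => (0%N, [::])
  | false :: w' => let: (p, v) := decode w' in (p.+1, v)
  | true :: w' => let: (p, v) := decode w' in (0%N, p :: v)
  end.

Lemma decodeK v : decode (omega_word v) = (0%N, v).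
Proof.
elim: v => [//|n v IH]; rewrite /= -/(omega_word v).
have -> : decode (nseq n false ++ omega_word v) = (n, v) by elim: n => //= n ->.
by [].
Qed.

Lemma FdB_to_T_word v : FdB_to_T (fwordU K v) = fwordU K (omega_word v).
Proof.
elim: v => [|n v IH]; first by rewrite !fwordU0; exact: rmorph1.
rewrite -cat1s fwordU_cat.
have -> : FdB_to_T (fwordU K [:: n] * fwordU K v) =
          FdB_to_T (fwordU K [:: n]) * FdB_to_T (fwordU K v).
  exact: rmorphM.
rewrite IH fwordU1 FdB_to_T_gen /= fwordU_cat; congr (_ * _).
rewrite -cat1s fwordU_cat fwordU1 /omega; congr (_ * _).
elim: n => [|n IHn]; first by rewrite expr0 fwordU0.
by rewrite exprS IHn /= -cat1s [RHS]fwordU_cat fwordU1.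
Qed.

Definition T_to_FdB : {linear T -> FdBalg K} :=
  flinlift (fun w : {fmonom bool} => fwordU K (decode w).2).

Lemma FdB_to_TK : cancel FdB_to_T T_to_FdB.
Proof.
apply: (@freealg_ext_linear K nat _ (T_to_FdB \o FdB_to_T) idfun) => v.
change (T_to_FdB (FdB_to_T (fwordU K v)) = fwordU K v).
by rewrite FdB_to_T_word; apply: etrans (flinlift_word _ _) _; rewrite decodeK.
Qed.

Lemma FdB_to_T_generated x : in_generated (@is_omega K) (FdB_to_T x).
Proof.
apply/asboolP; elim/freealg_ind: x => [|c v x IH].
  rewrite raddf0 -(addNr 1) -scaleN1r.
  by apply: generatedD; apply: generated1.
rewrite linearP; apply: generatedD IH.
elim: v => [|n v IH]; first by rewrite fwordU0 rmorph1; apply: generated1.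
rewrite -cat1s fwordU_cat rmorphM fwordU1; apply: generatedM IH.
by apply: generated_in; exists n; rewrite -FdB_to_T_gen.
Qed.

Lemma generated_FdB_to_T y :
  generated (@is_omega K) y -> exists x, y = FdB_to_T x.
Proof.
elim=> [_ [n ->]||c _ _ _ [x ->] _ [x' ->]|_ _ _ [x ->] _ [x' ->]].
- by exists (FdBa K n); rewrite FdB_to_T_gen.
- by exists 1; apply/esym; exact: rmorph1.
- by exists (c *: x + x'); apply/esym; exact: linearP.
- by exists (x * x'); apply/esym; exact: rmorphM.
Qed.

(** * The bialgebra structure of the subalgebra L *)

Definition FdB_to_L (x : FdBalg K) : Lalg K := Subalgebra (FdB_to_T_generated x).

Lemma FdB_to_L_linear : linear FdB_to_L.
Proof. by move=> c x y; apply: val_inj; exact: (linearP FdB_to_T). Qed.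

Lemma FdB_to_L_monoid_morphism : monoid_morphism FdB_to_L.
Proof.
split=> [|x y]; apply: val_inj; first exact: (rmorph1 FdB_to_T).
exact: (rmorphM FdB_to_T).
Qed.

HB.instance Definition _ :=
  GRing.isLinear.Build K (FdBalg K) (Lalg K) *:%R FdB_to_L FdB_to_L_linear.
HB.instance Definition _ :=
  GRing.isMonoidMorphism.Build (FdBalg K) (Lalg K) FdB_to_L FdB_to_L_monoid_morphism.

Definition L_to_FdB (y : Lalg K) : FdBalg K := T_to_FdB (Lincl K y).

Lemma FdB_to_LK : cancel FdB_to_L L_to_FdB.
Proof. by move=> x; rewrite /L_to_FdB -[RHS]FdB_to_TK. Qed.

Lemma L_to_FdBK : cancel L_to_FdB FdB_to_L.
Proof.
move=> y; apply: val_inj.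
have /asboolP /generated_FdB_to_T [x ex] := subalg_valP y.
change (FdB_to_T (T_to_FdB (subalg_val y)) = subalg_val y).
by rewrite ex FdB_to_TK.
Qed.

Lemma L_to_FdB_linear : linear L_to_FdB.
Proof. exact: (can2_linear FdB_to_LK L_to_FdBK). Qed.

Lemma L_to_FdB_monoid_morphism : monoid_morphism L_to_FdB.
Proof. exact: (can2_monoid_morphism FdB_to_LK L_to_FdBK). Qed.

HB.instance Definition _ :=
  GRing.isLinear.Build K (Lalg K) (FdBalg K) *:%R L_to_FdB L_to_FdB_linear.
HB.instance Definition _ :=
  GRing.isMonoidMorphism.Build (Lalg K) (FdBalg K) L_to_FdB L_to_FdB_monoid_morphism.

(** The coproduct of [L] is transported from the Faa di Bruno algebra, because
    restricting that of [T] would first require that [L ⊗ L] embeds in [T ⊗ T]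
    and contains the values taken on [L]. *)
Definition LDelta : {lrmorphism Lalg K -> Lalg K ⊗ Lalg K} :=
  tmap FdB_to_L FdB_to_L \o FdBDelta K \o L_to_FdB.

Definition Leps : {lrmorphism Lalg K -> K^o} := Teps K \o Lincl K.

Lemma FdB_to_T_morphism :
  is_bialgebra_morphism (FdBDelta K) (FdBeps K) (TDelta K) (Teps K) FdB_to_T.
Proof. by split=> x; [exact: FdB_to_T_Delta | exact: FdB_to_T_eps]. Qed.

Lemma FdB_bialgebra : is_bialgebra (FdBDelta K) (FdBeps K).
Proof.
apply: (bialgebra_split_mono FdB_to_TK FdB_to_T_morphism T_bialgebra).
Qed.

Lemma Lincl_morphism :
  is_bialgebra_morphism LDelta Leps (TDelta K) (Teps K) (Lincl K).
Proof.
split=> // y; rewrite -[in LHS](L_to_FdBK y).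
change (TDelta K (FdB_to_T (L_to_FdB y)) =
  tmap (Lincl K) (Lincl K) (tmap FdB_to_L FdB_to_L (FdBDelta K (L_to_FdB y)))).
rewrite FdB_to_T_Delta.
move: (FdBDelta K _); apply: tensor_ext => [||u v].
- exact: (@linearP _ _ _ _ (tmap FdB_to_T FdB_to_T)).
- exact: (@linearP _ _ _ _ (tmap (Lincl K) (Lincl K) \o tmap FdB_to_L FdB_to_L)).
by rewrite !tmap_tens.
Qed.

Lemma L_bialgebra : is_bialgebra LDelta Leps.
Proof.
have LK : cancel (Lincl K) (FdB_to_L \o T_to_FdB).
  by move=> y; exact: (L_to_FdBK y).
exact: (bialgebra_split_mono LK Lincl_morphism T_bialgebra).
Qed.

Lemma L_to_FdB_morphism :
  is_bialgebra_morphism LDelta Leps (FdBDelta K) (FdBeps K) L_to_FdB.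
Proof.
split=> y; last by rewrite -FdB_to_T_eps -[in RHS](L_to_FdBK y).
exact/esym/(tmapK FdB_to_LK FdB_to_LK).
Qed.
End FdBInT.

Theorem theorem2p7 (K : fieldType) :
  [/\ is_bialgebra (TDelta K) (Teps K),
      is_bialgebra (FdBDelta K) (FdBeps K)
    & exists (DeltaL : {lrmorphism Lalg K -> Lalg K ⊗ Lalg K})
             (epsL : {lrmorphism Lalg K -> K^o}),
      [/\ is_bialgebra DeltaL epsL,
          is_bialgebra_morphism DeltaL epsL (TDelta K) (Teps K) (Lincl K)
        & exists phi : {lrmorphism Lalg K -> FdBalg K},
            bijective phi /\
            is_bialgebra_morphism DeltaL epsL (FdBDelta K) (FdBeps K) phi]].
Proof.
split; [exact: T_bialgebra | exact: FdB_bialgebra | exists (LDelta K), (Leps K)].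
split; [exact: L_bialgebra | exact: Lincl_morphism |].
exists (@L_to_FdB K : {lrmorphism _ -> _}); split; last exact: L_to_FdB_morphism.
exact: Bijective (@L_to_FdBK K) (@FdB_to_LK K).
Qed.
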